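(* Let $n \in \mathbb{N}$ and let $A$ be a unital, separable C*-algebra such that $M_{n^\infty} \otimes A \cong A$. Then $$\operatorname{dist}(U(a),U(b)) = \operatorname{dist}(U(a^{(n)}),U(b^{(n)}))$$ for all $a,b \in A$.
   Context: $\mathbb{N}=\{1,2,\dots\}$. $M_n$ is the C*-algebra of $n\times n$ complex matrices and $M_{n^\infty}$ is the UHF algebra $\bigotimes_{i=1}^\infty M_n$ (C*-inductive limit of $M_n \to M_{n^2}\to M_{n^3} \to \cdots$ under unital embeddings); tensor products are minimal. For a unital C*-algebra $B$ with unitary group $U(B)$ and $x \in B$, the unitary orbit of $x$ is $U(x) = \{u^*xu : u \in U(B)\}$, and for $x,y\in B$, $\operatorname{dist}(U(x),U(y)) = \inf\{\|x'-y'\| : x' \in U(x), y' \in U(y)\}$. For $a \in A$, $a^{(n)} = 1_{M_n}\otimes a \in M_n \otimes A = M_n(A)$ is the $n$-fold direct sum of $a$ with itself. The quantity $\operatorname{dist}(U(a),U(b))$ is computed using unitaries of $A$, and $\operatorname{dist}(U(a^{(n)}),U(b^{(n)}))$ using unitaries of $M_n(A)$. *)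

(* Defs.v *)
From HB Require Import structures.
From mathcomp Require Export all_boot all_order all_algebra.
From mathcomp Require Export all_classical all_reals all_analysis.
From mathcomp.real_closed Require Export complex mxtens.

Set Implicit Arguments.
Unset Strict Implicit.
Unset Printing Implicit Defensive.

Import Order.TTheory GRing.Theory Num.Theory.
Import numFieldNormedType.Exports.

Local Open Scope classical_set_scope.
Local Open Scope ring_scope.

HB.mixin Record PzRing_hasStar A of GRing.PzRing A := {
  star : A -> A;
  starK : involutive star;
  starD : {morph star : x y / x + y};
  starM : forall x y, star (x * y) = star y * star x }.

#[short(type="starRingType")]
HB.structure Definition StarRing := {A of PzRing_hasStar A & GRing.PzRing A}.

(* Unital C*-algebras.  The norm is a field of its own, with values in R,
   because Hierarchy-Builder rejects a join of algType with normedModType: the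
   common joins of rings and normed zmodules are numDomainTypes.  Completeness
   and density are therefore stated for this norm. *)
HB.mixin Record isCStar (R : realType) A of
    StarRing A & GRing.Algebra R[i] A := {
  cnorm : A -> R;
  cnorm_eq0 : forall x : A, cnorm x = 0 -> x = 0;
  cnormD : forall x y : A, cnorm (x + y) <= cnorm x + cnorm y;
  cnormZ : forall (c : R[i]) (x : A), cnorm (c *: x) = ComplexField.Normc.normc c * cnorm x;
  cnormM : forall x y : A, cnorm (x * y) <= cnorm x * cnorm y;
  cnorm_complete : forall u : nat -> A,
    (forall e : R, 0 < e -> exists N : nat, forall m n,
       (N <= m)%N -> (N <= n)%N -> cnorm (u m - u n) < e) ->
    exists l : A, (fun n => cnorm (u n - l)) @ \oo --> (0 : R);
  starZ : forall (c : R[i]) (x : A), star (c *: x) = c^* *: star x;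
  cstar_identity : forall x : A, cnorm (star x * x) = cnorm x ^+ 2 }.

#[short(type="cstarType")]
HB.structure Definition CStar (R : realType) :=
  {A of isCStar R A & StarRing A & GRing.Algebra R[i] A}.

Section ComplexStar.
Variable R : realType.

Let conjK : involutive (Num.conj : R[i] -> R[i]).
Proof. exact: conjCK. Qed.
Let conjD : {morph (Num.conj : R[i] -> R[i]) : x y / x + y}.
Proof. exact: rmorphD. Qed.
Let conjM (x y : R[i]) : (x * y)^* = y^* * x^*.
Proof. by rewrite rmorphM mulrC. Qed.

HB.instance Definition _ := PzRing_hasStar.Build R[i] conjK conjD conjM.
End ComplexStar.

(* Conjugate transpose. *)
Section MatrixStar.
Variables (A : starRingType) (n : nat).

Definition mxstar (x : 'M[A]_n) : 'M[A]_n := map_mx star x^T.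

Let mxstarK : involutive mxstar.
Proof. by move=> x; apply/matrixP => i j; rewrite !mxE starK. Qed.
Let mxstarD : {morph mxstar : x y / x + y}.
Proof. by move=> x y; apply/matrixP => i j; rewrite !mxE starD. Qed.
Let star0 : star (0 : A) = 0.
Proof. by apply: (addrI (star 0)); rewrite -starD !addr0. Qed.
Let mxstarM (x y : 'M[A]_n) : mxstar (x * y) = mxstar y * mxstar x.
Proof.
apply/matrixP => i j; rewrite !mxE (big_morph _ (@starD A) star0).
by apply: eq_bigr => k _; rewrite !mxE starM.
Qed.

HB.instance Definition _ :=
  PzRing_hasStar.Build 'M[A]_n mxstarK mxstarD mxstarM.
End MatrixStar.

Definition unitary (B : starRingType) : set B :=
  [set u | star u * u = 1 /\ u * star u = 1].

Definition unitary_orbit (B : starRingType) (x : B) : set B :=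
  [set star u * x * u | u in @unitary B].

(* Distance between the unitary orbits of x and y for the norm N on B. *)
Definition orbit_dist (R : realType) (B : starRingType) (N : B -> R)
    (x y : B) : R :=
  inf [set N (x' - y') | x' in unitary_orbit x & y' in unitary_orbit y].

Section MatrixNorm.
Variables (R : realType) (A : cstarType R).

(* The norm of v in the Hilbert A-module A^n, whose A-valued inner product is
   <v, w> = \sum_i (v i)^* (w i). *)
Definition module_norm n (v : 'cV[A]_n) : R :=
  Num.sqrt (cnorm (\sum_(i < n) star (v i 0) * v i 0)).

(* The C*-norm of M_n(A): the operator norm for its action by left
   multiplication on A^n. *)
Definition mx_norm_op n (x : 'M[A]_n) : R :=
  sup [set module_norm (x *m v) | v in [set v | module_norm v <= 1]].
End MatrixNorm.

Definition star_multiplicative (A B : starRingType) (f : A -> B) : Prop :=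
  monoid_morphism f /\ {morph f : x / star x}.

Definition star_hom (R : realType) (A B : cstarType R) (f : A -> B) : Prop :=
  linear f /\ star_multiplicative f.

Definition star_isomorphic (R : realType) (A B : cstarType R) : Prop :=
  exists2 f : A -> B, star_hom f & bijective f.

Definition norm_dense (R : realType) (A : cstarType R) (S : set A) : Prop :=
  forall (x : A) (e : R), 0 < e -> exists2 y, S y & cnorm (x - y) < e.

Definition separable_cstar (R : realType) (A : cstarType R) : Prop :=
  exists2 S : set A, countable S & norm_dense S.

(* U is the C*-inductive limit of M_n -> M_(n^2) -> M_(n^3) -> ... along
   x |-> 1 (x) x, i.e., the completion of the increasing union of these
   algebras (injective *-homomorphisms of C*-algebras are isometric).  The
   sizes match because n ^ k.+2 is convertible to n * n ^ k.+1. *)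
Definition is_uhf (R : realType) (n : nat) (U : cstarType R) : Prop :=
  exists phi : forall k, 'M[R[i]]_(n ^ k.+1) -> U,
    [/\ forall k, [/\ linear (phi k), star_multiplicative (phi k)
                    & injective (phi k)],
        forall k (x : 'M[R[i]]_(n ^ k.+1)),
          phi k.+1 ((1%:M : 'M[R[i]]_n) *t x) = phi k x
      & norm_dense (\bigcup_k range (phi k))].

Section TensorProduct.
Variables (R : realType) (B A : cstarType R).

Definition lin_indep m (b : 'I_m -> B) : Prop :=
  forall c : 'I_m -> R[i], \sum_(i < m) c i *: b i = 0 -> forall i, c i = 0.

(* f and g are unital *-homomorphisms with commuting ranges, and
   b (x) a |-> f b * g a is injective on the algebraic tensor product of B and
   A; thus the norm of D restricts to a C*-norm there, and every C*-norm on the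
   algebraic tensor product arises in this way. *)
Definition tensor_pair (D : cstarType R) (f : B -> D) (g : A -> D) : Prop :=
  [/\ star_hom f, star_hom g, forall b a, f b * g a = g a * f b
    & forall m (b : 'I_m -> B) (a : 'I_m -> A), lin_indep b ->
        \sum_(i < m) f (b i) * g (a i) = 0 -> forall i, a i = 0].

(* C is the completion of the algebraic tensor product of B and A for its
   minimal C*-norm. *)
Definition is_min_tensor (C : cstarType R) : Prop :=
  exists (f : B -> C) (g : A -> C),
    [/\ tensor_pair f g,
        norm_dense [set x : C | exists m (b : 'I_m -> B) (a : 'I_m -> A),
                             x = \sum_(i < m) f (b i) * g (a i)]
      & forall (D : cstarType R) (f' : B -> D) (g' : A -> D),
          tensor_pair f' g' ->
          forall m (b : 'I_m -> B) (a : 'I_m -> A),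
            cnorm (\sum_(i < m) f (b i) * g (a i))
              <= cnorm (\sum_(i < m) f' (b i) * g' (a i))].
End TensorProduct.

(* Main.v *)
Require Import Defs.
From mathcomp Require Import ring lra.
Set Implicit Arguments.
Unset Strict Implicit.
Unset Printing Implicit Defensive.
Import Order.TTheory GRing.Theory Num.Theory.
Import numFieldNormedType.Exports.
Local Open Scope classical_set_scope.
Local Open Scope ring_scope.

(* Since A is isomorphic to UHF (x) A, it contains a sequence of systems of
   n x n matrix units e k that asymptotically commute with every element.  The
   maps [amplify k] : X |-> \sum_(i, j) X i j * e k i j from M_n(A) to A are
   then asymptotically *-homomorphic, send a^(n) to a, and have norms
   asymptotically equal to the norm of M_n(A).  Hence unitaries of M_n(A)
   implementing almost optimal conjugations of a^(n) and b^(n) are carried to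
   near-unitaries of A doing the same for a and b, and near-unitaries are close
   to unitaries.  Evaluating the Hilbert module norm through the e k also
   replaces any use of positivity in C*-algebras. *)

(** * Identities in star rings and unitary orbits *)

Section StarRing.
Variable B : starRingType.
Implicit Types x y : B.

Lemma star0 : star (0 : B) = 0.
Proof. by apply: (addrI (star 0)); rewrite -starD !addr0. Qed.

Lemma starN x : star (- x) = - star x.
Proof. by apply: (addrI (star x)); rewrite -starD !subrr star0. Qed.

Lemma starB x y : star (x - y) = star x - star y.
Proof. by rewrite starD starN. Qed.

Lemma star1 : star (1 : B) = 1.
Proof.
by rewrite -[RHS]starK -[star 1]mul1r starM starK.
Qed.

Lemma star_sum (I : Type) (r : seq I) (P : pred I) (F : I -> B) :
  star (\sum_(i <- r | P i) F i) = \sum_(i <- r | P i) star (F i).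
Proof. exact: (big_morph _ (@starD B) star0). Qed.

Lemma unitary1 : unitary (1 : B).
Proof. by split; rewrite star1 mulr1. Qed.

Lemma unitary_orbit_refl x : unitary_orbit x x.
Proof. by exists 1; [exact: unitary1|rewrite star1 mul1r mulr1]. Qed.

Lemma orbit_dist_values_neq0 (R : realType) (N : B -> R) x y :
  [set N (x' - y') | x' in unitary_orbit x & y' in unitary_orbit y] !=set0.
Proof.
exists (N (x - y)), x; first exact: unitary_orbit_refl.
by exists y; first exact: unitary_orbit_refl.
Qed.

End StarRing.

(** * Norm estimates and completeness in C*-algebras *)

Lemma cvg_half_geometric (R : realType) (K : R) :
  (fun m => K * 2^-1 ^+ m) @ \oo --> (0 : R).
Proof.
by apply: cvg_geometric; rewrite ger0_norm ?invr_ge0 // invf_lt1 ?ltr1n.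
Qed.

Section CStarBasics.
Variables (R : realType) (A : cstarType R).
Implicit Types x y z : A.

Lemma starZr (c : R) x : star (c%:C%C *: x) = c%:C%C *: star x.
Proof. by rewrite starZ conj_Creal //; apply/complex_realP; exists c. Qed.

Lemma cnorm0 : cnorm (0 : A) = 0.
Proof. by rewrite -(scale0r 0) cnormZ ComplexField.Normc.normc0 mul0r. Qed.

Lemma cnormZr (c : R) x : cnorm (c%:C%C *: x) = `|c| * cnorm x.
Proof. by rewrite cnormZ /= expr0n addr0 sqrtr_sqr. Qed.

Lemma scaler_half x : (2^-1)%:C%C *: (x + x) = x.
Proof.
rewrite scalerDr -scalerDl -rmorphD /=.
by rewrite [X in X%:C%C](_ : _ = 1) ?scale1r //; lra.
Qed.

Lemma cnorm_half x : cnorm ((2^-1)%:C%C *: x) = 2^-1 * cnorm x.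
Proof. by rewrite cnormZr ger0_norm // invr_ge0. Qed.

Lemma cnormN x : cnorm (- x) = cnorm x.
Proof.
have -> : - x = (-1)%:C%C *: x by rewrite rmorphN1 scaleN1r.
by rewrite cnormZr normrN1 mul1r.
Qed.

Lemma cnorm_ge0 x : 0 <= cnorm x.
Proof. by have := cnormD x (- x); rewrite subrr cnorm0 cnormN; lra. Qed.

Lemma cnormB x y : cnorm (x - y) = cnorm (y - x).
Proof. by rewrite -cnormN opprB. Qed.

Lemma cnorm_leB x y : cnorm x <= cnorm y + cnorm (x - y).
Proof. by rewrite -{1}(subrK y x) addrC cnormD. Qed.

Lemma cnorm_leD x y (a b : R) :
  cnorm x <= a -> cnorm y <= b -> cnorm (x + y) <= a + b.
Proof. by move=> xa yb; apply: le_trans (cnormD _ _) _; apply: lerD. Qed.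

Lemma cnorm_leM x y (a b : R) :
  cnorm x <= a -> cnorm y <= b -> cnorm (x * y) <= a * b.
Proof.
move=> xa yb; apply: le_trans (cnormM _ _) _.
by apply: ler_pM; rewrite ?cnorm_ge0.
Qed.

Lemma cnorm_le_sum (I : Type) (r : seq I) (P : pred I) (F : I -> A) :
  cnorm (\sum_(i <- r | P i) F i) <= \sum_(i <- r | P i) cnorm (F i).
Proof.
elim/big_rec2: _ => [|i a x _ xa]; first by rewrite cnorm0.
exact: cnorm_leD.
Qed.

Lemma cnorm_le0 x : (forall e : R, 0 < e -> cnorm x <= e) -> x = 0.
Proof.
by move=> xe; apply: cnorm_eq0; apply: le_anti; rewrite cnorm_ge0 andbT;
  apply/ler_addgt0Pr => e /xe; rewrite add0r.
Qed.

(** The C*-identity bounds [cnorm y ^+ 2] by [cnorm (star y) * cnorm y]; as [star] is an involution,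
    this one inequality suffices. *)
Lemma cnorm_star x : cnorm (star x) = cnorm x.
Proof.
suff le y : cnorm y <= cnorm (star y).
  by apply: le_anti; rewrite le -{2}(starK x) le.
have [->|y0] := eqVneq (cnorm y) 0; first exact: cnorm_ge0.
have y_gt0 : 0 < cnorm y by rewrite lt_def y0 cnorm_ge0.
by rewrite -(ler_pM2r y_gt0) -expr2 -cstar_identity cnormM.
Qed.

Lemma cnorm1 : cnorm (1 : A) = 1.
Proof.
have := cstar_identity (1 : A); rewrite star1 mulr1 expr2.
have [/cnorm_eq0/eqP|n1 n1n1] := eqVneq (cnorm (1 : A)) 0.
  by rewrite oner_eq0.
by apply: (mulfI n1); rewrite mulr1.
Qed.

Lemma cnorm_isometry x : star x * x = 1 -> cnorm x = 1.
Proof.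
move=> xx; apply/eqP; rewrite -(@eqrXn2 _ 2) ?cnorm_ge0 //.
by rewrite -cstar_identity xx cnorm1 expr1n.
Qed.

Lemma cnorm_unitary x : unitary x -> cnorm x = 1.
Proof. by case=> /cnorm_isometry. Qed.

(** The hypothesis makes [x] a projection: its left side is self-adjoint, hence [x] is also
    idempotent. The C*-identity then reads [cnorm x = cnorm x ^+ 2]. *)
Lemma cnorm_projection_le1 x : star x * x = x -> cnorm x <= 1.
Proof.
move=> xx; have := cstar_identity x; rewrite xx.
have := cnorm_ge0 x; nra.
Qed.

(** Powers of [x] stay self-adjoint, so the C*-identity squares the norm at each doubling of the
    exponent. *)
Lemma cnorm_selfadjointX x j :
  star x = x -> cnorm (x ^+ (2 ^ j)) = cnorm x ^+ (2 ^ j).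
Proof.
move=> xs; have xXs m : star (x ^+ m) = x ^+ m.
  by elim: m => [|m IH]; rewrite ?expr0 ?star1 // exprSr starM IH xs -exprS
    -exprSr.
elim: j => [|j IH]; first by rewrite !expr1.
by rewrite expnSr !exprM -IH -cstar_identity xXs -expr2.
Qed.

Lemma cauchy_geometric (u : nat -> A) (K : R) :
  (forall m, cnorm (u m.+1 - u m) <= K * 2^-1 ^+ m) ->
  exists l, forall m, cnorm (u m - l) <= 2 * K * 2^-1 ^+ m.
Proof.
move=> uK.
have K0 : 0 <= K by have := le_trans (cnorm_ge0 _) (uK 0%N);
  rewrite expr0 mulr1.
have half0 m : 0 <= 2^-1 ^+ m :> R by rewrite exprn_ge0 // invr_ge0.
(* The factor [1 - 2^-1 ^+ d] is that of the exact partial geometric sum; it closes the induction on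
   [d]. *)
have uD m d : cnorm (u (m + d)%N - u m) <= 2 * K * 2^-1 ^+ m * (1 - 2^-1 ^+ d).
  elim: d => [|d IH]; first by rewrite addn0 subrr cnorm0 expr0 subrr mulr0.
  rewrite addnS -(subrKA (u (m + d)%N)).
  apply: le_trans (cnorm_leD (uK _) IH) _.
  by rewrite exprD exprS; have := half0 m; have := half0 d; nra.
have uC m n : (m <= n)%N -> cnorm (u n - u m) <= 2 * K * 2^-1 ^+ m.
  move=> /subnKC <-; apply: le_trans (uD _ _) _.
  by rewrite ler_piMr ?mulr_ge0 // gerBl.
(* Two terms past [N] are each within [2 * K * 2^-1 ^+ N] of [u N], whence [4 * K]. *)
have cv0 := cvg_half_geometric (4 * K).
have [e e0|l ul] := cnorm_complete u.
  have [N _ NP] := cvgr0_norm_lt _ cv0 e e0.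
  exists N => m n Nm Nn; have := NP N (leqnn _); rewrite /= ger0_norm;
    last first.
    by rewrite !mulr_ge0.
  apply: le_lt_trans; rewrite -(subrKA (u N)).
  apply: le_trans (cnorm_leD (uC _ _ Nm) (lexx _)) _.
  rewrite cnormB; apply: le_trans (lerD (lexx _) (uC _ _ Nn)) _; lra.
exists l => m; apply/ler_addgt0Pr => e e0.
have [N _ NP] := cvgr0_norm_lt _ ul e e0.
have := NP (maxn m N) (leq_maxr _ _);
  rewrite /= ger0_norm ?cnorm_ge0 // => /ltW ule.
rewrite -(subrKA (u (maxn m N))) cnorm_leD // cnormB uC ?leq_maxl //.
Qed.

End CStarBasics.

(** * Asymptotic equality of sequences *)

Section Asymptotics.
Variables (R : realType) (A : cstarType R).
Implicit Types (x y : A) (u v w : nat -> A).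

(** On bounded sequences this is equality modulo null sequences; the bounds required for products
    are carried separately by [norm_bounded]. *)
Definition asymp u v : Prop :=
  (fun k => cnorm (u k - v k)) @ \oo --> (0 : R).

Definition norm_bounded u : Prop := exists M : R, forall k, cnorm (u k) <= M.

Lemma asympP u v : asymp u v <->
  forall e : R, 0 < e -> \forall k \near \oo, cnorm (u k - v k) <= e.
Proof.
split=> [/cvgr0Pnorm_le uv e /uv | uv].
  by apply: filterS => k; rewrite ger0_norm ?cnorm_ge0.
apply/cvgr0Pnorm_le => e /uv.
by apply: filterS => k; rewrite ger0_norm ?cnorm_ge0.
Qed.

Lemma asymp_eventually u v : (\forall k \near \oo, u k = v k) -> asymp u v.
Proof.
move=> uv; apply/asympP => e e0; move: uv; apply: filterS => k ->.
by rewrite subrr cnorm0 ltW.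
Qed.

Lemma asymp_eq u v : u =1 v -> asymp u v.
Proof. by move=> uv; apply: asymp_eventually; apply: nearW. Qed.

Lemma asymp_refl u : asymp u u.
Proof. exact: asymp_eq. Qed.

Lemma asymp_sym u v : asymp u v -> asymp v u.
Proof.
move=> /asympP uv; apply/asympP => e /uv.
by apply: filterS => k; rewrite cnormB.
Qed.

Lemma asymp_squeeze (f : nat -> R) u v : f @ \oo --> (0 : R) ->
  (\forall k \near \oo, cnorm (u k - v k) <= f k) -> asymp u v.
Proof.
move=> f0 uvf; apply: (squeeze_cvgr _ (cvg_cst 0) f0).
by move: uvf; apply: filterS => k; rewrite cnorm_ge0.
Qed.

Lemma asymp_trans v u w : asymp u v -> asymp v w -> asymp u w.
Proof.
move=> uv vw; apply: (asymp_squeeze (f :=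
  fun k => cnorm (u k - v k) + cnorm (v k - w k))).
  by rewrite -(addr0 0); apply: cvgD.
by apply: nearW => k; rewrite -(subrKA (v k)) cnormD.
Qed.

Lemma asympD u v u' v' : asymp u u' -> asymp v v' ->
  asymp (fun k => u k + v k) (fun k => u' k + v' k).
Proof.
move=> uu vv; apply: (asymp_squeeze (f :=
  fun k => cnorm (u k - u' k) + cnorm (v k - v' k))).
  by rewrite -(addr0 0); apply: cvgD.
by apply: nearW => k; rewrite opprD addrACA cnormD.
Qed.

Lemma asympN u u' : asymp u u' -> asymp (fun k => - u k) (fun k => - u' k).
Proof.
move=> uu; apply: asymp_squeeze uu _.
by apply: nearW => k; rewrite -opprD cnormN.
Qed.

Lemma asympB u v u' v' : asymp u u' -> asymp v v' ->
  asymp (fun k => u k - v k) (fun k => u' k - v' k).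
Proof. by move=> uu vv; apply: asympD => //; apply: asympN. Qed.

Lemma asymp_sum (I : Type) (r : seq I) (u v : I -> nat -> A) :
  (forall i, asymp (u i) (v i)) ->
  asymp (fun k => \sum_(i <- r) u i k) (fun k => \sum_(i <- r) v i k).
Proof.
move=> uv; elim: r => [|i r IH].
  by apply: asymp_eq => k; rewrite !big_nil.
apply: (@asymp_trans (fun k => u i k + \sum_(j <- r) u j k)).
  by apply: asymp_eq => k; rewrite big_cons.
by apply: asymp_trans (asympD (uv i) IH) _; apply: asymp_eq => k;
  rewrite big_cons.
Qed.

Lemma asymp_star u v : asymp u v ->
  asymp (fun k => star (u k)) (fun k => star (v k)).
Proof.
move=> uv; apply: asymp_squeeze uv _.
by apply: nearW => k; rewrite -starB cnorm_star.
Qed.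

(** The splitting [u v - u' v' = u (v - v') + (u - u') v'] dictates which two sequences are assumed
    bounded. *)
Lemma asympM u v u' v' : norm_bounded u -> norm_bounded v' ->
  asymp u u' -> asymp v v' ->
  asymp (fun k => u k * v k) (fun k => u' k * v' k).
Proof.
move=> [M uM] [N vN] uu vv.
apply: (asymp_squeeze (f :=
  fun k => M * cnorm (v k - v' k) + cnorm (u k - u' k) * N)).
  have -> : 0 = M * 0 + 0 * N by rewrite mulr0 mul0r addr0.
  apply: cvgD.
    exact: cvgM (cvg_cst _) vv.
  exact: cvgM uu (cvg_cst _).
apply: nearW => k; rewrite -(subrKA (u k * v' k)) -mulrBr -mulrBl.
by apply: cnorm_leD; apply: cnorm_leM.
Qed.

Lemma asympMl u v v' : norm_bounded u -> asymp v v' ->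
  asymp (fun k => u k * v k) (fun k => u k * v' k).
Proof.
move=> [M uM] vv; apply: (asymp_squeeze (f := fun k => M * cnorm (v k - v' k))).
  by rewrite -(mulr0 M); exact: cvgM (cvg_cst _) vv.
by apply: nearW => k; rewrite -mulrBr cnorm_leM.
Qed.

Lemma asympMr u v v' : norm_bounded u -> asymp v v' ->
  asymp (fun k => v k * u k) (fun k => v' k * u k).
Proof.
move=> [M uM] vv; apply: (asymp_squeeze (f := fun k => cnorm (v k - v' k) * M)).
  by rewrite -(mul0r M); exact: cvgM vv (cvg_cst _).
by apply: nearW => k; rewrite -mulrBl cnorm_leM.
Qed.

Lemma asymp_cst x y : asymp (fun=> x) (fun=> y) -> x = y.
Proof.
move=> /asympP xy; apply/eqP; rewrite -subr_eq0; apply/eqP; apply: cnorm_le0.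
by move=> e /xy [N _ /(_ N (leqnn _))].
Qed.

Lemma asymp_norm_le u v : asymp u v ->
  forall e : R, 0 < e -> \forall k \near \oo, cnorm (u k) <= cnorm (v k) + e.
Proof.
move=> /asympP uv e /uv; apply: filterS => k uvk.
by apply: le_trans (cnorm_leB _ _) _; apply: lerD.
Qed.

Lemma norm_bounded_cst x : norm_bounded (fun=> x).
Proof. by exists (cnorm x). Qed.

Lemma norm_boundedM u v : norm_bounded u -> norm_bounded v ->
  norm_bounded (fun k => u k * v k).
Proof. by move=> [M uM] [N vN]; exists (M * N) => k; apply: cnorm_leM. Qed.

Lemma norm_bounded_star u : norm_bounded u ->
  norm_bounded (fun k => star (u k)).
Proof. by move=> [M uM]; exists M => k; rewrite cnorm_star. Qed.

Lemma norm_bounded_sum (I : Type) (r : seq I) (u : I -> nat -> A) :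
  (forall i, norm_bounded (u i)) -> norm_bounded (fun k => \sum_(i <- r) u i k).
Proof.
move=> /choice[M uM]; exists (\sum_(i <- r) M i) => k.
by apply: le_trans (cnorm_le_sum _ _ _) _; apply: ler_sum.
Qed.

Lemma geometric_asymp u (K : R) :
  (forall m, cnorm (u m.+1 - u m) <= K * 2^-1 ^+ m) ->
  exists2 l, asymp u (fun=> l) & forall m, cnorm (u m - l) <= 2 * K * 2^-1 ^+ m.
Proof.
move=> /cauchy_geometric[l ul]; exists l => //.
apply: (asymp_squeeze (f := fun m => 2 * K * 2^-1 ^+ m)); last exact: nearW.
exact: cvg_half_geometric.
Qed.

End Asymptotics.

(** * Square roots by iteration, and unitaries close to almost unitary elements *)

Section Unitaries.
Variables (R : realType) (A : cstarType R).
Implicit Types (x y h w : A).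

(* [1 - y] is the square root, where [y] is the fixed point of
   [y |-> (h ^ 2 + y ^ 2) / 2]. *)
Lemma sqrt_1_sub_sqr h : star h = h -> cnorm h <= 2^-1 ->
  exists s, [/\ star s = s, s * h = h * s & s * s = 1 - h * h].
Proof.
move=> hs h2; pose c : R[i] := (2^-1)%:C%C.
pose F y := c *: (h * h + y * y).
pose u m := iter m F 0.
have u2 m : cnorm (u m) <= 2^-1.
  elim: m => [|m IH]; first by rewrite cnorm0 invr_ge0.
  rewrite /u iterS -/(u m) cnorm_half.
  have := cnorm_leD (cnorm_leM h2 h2) (cnorm_leM IH IH); lra.
have us m : star (u m) = u m.
  elim: m => [|m IH]; first exact: star0.
  by rewrite /u iterS -/(u m) starZr starD !starM hs IH.
have uh m : u m * h = h * u m.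
  elim: m => [|m IH]; first by rewrite mul0r mulr0.
  rewrite /u iterS -/(u m) -scalerAl -scalerAr mulrDl mulrDr -!mulrA IH.
  by rewrite [u m * (h * _)]mulrA IH -mulrA.
have [l ul _] : exists2 l, asymp u (fun=> l) &
    forall m, cnorm (u m - l) <= 2 * cnorm (u 1) * 2^-1 ^+ m.
  apply: geometric_asymp; elim=> [|m IH]; first by rewrite subr0 mulr1.
  (* A difference of squares without commutativity; both iterates have norm at most [2^-1], so each
     step halves the increment. *)
  have -> : u m.+2 - u m.+1 =
      c *: (u m.+1 * (u m.+1 - u m) + (u m.+1 - u m) * u m).
    rewrite mulrBr mulrBl subrKA {1 2}/u !iterS -/(u m) -/(F (u m)).
    by rewrite -/(u m.+1) -scalerBr opprD addrACA subrr add0r.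
  rewrite cnorm_half exprS.
  have := cnorm_leD (cnorm_leM (u2 m.+1) IH) (cnorm_leM IH (u2 m)); lra.
have ub : norm_bounded u by exists 2^-1.
have cb x : norm_bounded (fun=> x) by exact: norm_bounded_cst.
have ls : star l = l.
  apply: asymp_cst; apply: (asymp_trans _ ul); apply: asymp_sym.
  by apply: asymp_trans (asymp_star ul); apply: asymp_eq => k; rewrite us.
have lh : l * h = h * l.
  apply: asymp_cst; apply: asymp_trans (asympMl (cb h) ul).
  apply: asymp_sym; apply: asymp_trans (asympMr (cb h) ul).
  by apply: asymp_eq => k; rewrite uh.
(* The fixed point equation, doubled; it says that [1 - l] squares to [1 - h * h]. *)
have lF : l + l = h * h + l * l.
  apply: (asymp_cst (x := l + l));
    apply: asymp_trans (asympD (asymp_refl _) (asympM ub (cb _) ul ul)).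
  apply: asymp_sym; have uS : asymp (fun k => u k.+1) (fun=> l).
    by move: ul; rewrite /asymp -(cvg_shiftS (fun k => cnorm (u k - l))).
  apply: asymp_trans (asympD uS uS); apply: asymp_eq => k.
  by rewrite /u iterS -/(u k) /F -scalerDr scaler_half.
exists (1 - l); split.
- by rewrite starB star1 ls.
- by rewrite mulrBl mulrBr lh mul1r mulr1.
rewrite mulrBr mulr1 mulrBl mul1r opprB addrA addrAC.
by rewrite -(addrA 1) -opprD lF opprD addrA subrK.
Qed.

(* Newton-Schulz iteration [w |-> w (3 - w^* w) / 2]. *)
Lemma near_unitary w (d : R) : d <= 2^-1 ->
  cnorm (1 - star w * w) <= d -> cnorm (1 - w * star w) <= d ->
  exists2 u, unitary u & cnorm (w - u) <= 4 * d.
Proof.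
move=> d2 wd wd'; pose c : R[i] := (2^-1)%:C%C.
have d0 : 0 <= d by apply: le_trans (cnorm_ge0 _) wd.
(* This is [(3 - x) / 2], expanded around 1. *)
pose g x := 1 + c *: (1 - x).
have gE x t : cnorm (1 - x) <= t -> t <= 2^-1 ->
  cnorm (1 - g x * x * g x) <= 2^-1 * t.
  move=> xt t2; pose y := c *: (1 - x).
  (* No term of first order in [y] survives, so the defect shrinks quadratically; for [t] at most
     [2^-1] it is at least halved. *)
  have -> : 1 - g x * x * g x = y * y + y * y + y * y + (y * y * y + y * y * y).
    have -> : x = 1 - y - y by rewrite -addrA -opprD
      -scalerDr scaler_half subKr.
    rewrite /g -/y.
    have -> : c *: (1 - (1 - y - y)) = y
      by rewrite -!addrA -opprD subKr scaler_half.
    (* Only [y] occurs, so the identity is proved by [ring] in the commutative polynomial ring and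
       then evaluated at [y]. *)
    have /(congr1 (horner_alg y)) : 1 - (1 + 'X) * (1 - 'X - 'X) * (1 + 'X) =
      'X * 'X + 'X * 'X + 'X * 'X + ('X * 'X * 'X + 'X * 'X * 'X) :> {poly
        R[i]} by ring.
    by rewrite !(rmorphM, rmorphD, rmorphN, rmorph1) /= !horner_algX.
  have yt : cnorm y <= 2^-1 * t by rewrite cnorm_half ler_wpM2l ?invr_ge0.
  have y2 := cnorm_leM yt yt; have y3 := cnorm_leM y2 yt.
  apply: le_trans (cnorm_leD (cnorm_leD (cnorm_leD y2 y2) y2) (cnorm_leD y3
    y3)) _.
  have t0 : 0 <= t by apply: le_trans (cnorm_ge0 _) xt.
  nra.
pose F v := v * g (star v * v).
(* The correction factor slides through [v], so [gE] controls both [1 - star v * v] and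
   [1 - v * star v]. *)
have Fsym v : F v = g (v * star v) * v.
  by rewrite /F /g mulrDr mulrDl mulr1 mul1r -scalerAr -scalerAl mulrBr mulrBl
    mulr1 mul1r mulrA.
have gs x : star (g x) = g (star x) by rewrite /g starD starZr starB star1.
have sgs v : star (star v * v) = star v * v by rewrite starM starK.
pose u m := iter m F w.
have ud m : cnorm (1 - star (u m) * u m) <= d * 2^-1 ^+ m /\
            cnorm (1 - u m * star (u m)) <= d * 2^-1 ^+ m.
  elim: m => [|m [IH1 IH2]]; first by rewrite !mulr1.
  have hm : d * 2^-1 ^+ m <= 2^-1.
    apply: le_trans d2; rewrite ler_piMr // exprn_ile1 //
      ?invr_ge0 // invf_le1 // ler1n //.
  have -> : d * 2^-1 ^+ m.+1 = 2^-1 * (d * 2^-1 ^+ m) by rewrite exprS mulrCA.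
  rewrite /u iterS -/(u m); split.
    rewrite {1}/F starM gs sgs /F -!mulrA [_ * (u m * _)]mulrA [g _ * _]mulrA.
    exact: gE.
  rewrite !Fsym starM gs starM starK !mulrA -[g _ * u m * _]mulrA.
  by rewrite -(mulrA 2^-1); apply: gE.
have un m : cnorm (u m) <= 2.
  have [u1 _] := ud m.
  have : cnorm (star (u m) * u m) <= 2.
    apply: le_trans (cnorm_leB _ 1) _; rewrite cnorm1 cnormB.
    have : d * 2^-1 ^+ m <= d.
      by rewrite ler_piMr // exprn_ile1 // ?invr_ge0 // invf_le1 // ler1n.
    lra.
  rewrite cstar_identity; have := cnorm_ge0 (u m); nra.
have [l ul /(_ 0%N) lw] : exists2 l, asymp u (fun=> l) &
    forall m, cnorm (u m - l) <= 2 * (2 * d) * 2^-1 ^+ m.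
  apply: geometric_asymp => m; rewrite /u iterS -/(u m) /F /g mulrDr mulr1.
  rewrite addrAC subrr add0r -scalerAr cnorm_half; have [u1 _] := ud m.
  have := cnorm_leM (un m) u1; have := le_trans (cnorm_ge0 _) u1; lra.
exists l; last by move: lw; rewrite mulr1 (_ : 2 * (2 * d) = 4 * d) //; lra.
have ub : norm_bounded u by exists 2.
have lb := norm_bounded_cst l.
have sub := norm_bounded_star ub; have slb := norm_bounded_star lb.
have d20 := cvg_half_geometric d.
split; apply: asymp_cst.
  apply: asymp_trans (asymp_sym (asympM sub lb (asymp_star ul) ul)) _.
  by apply: asymp_squeeze d20 _; apply: nearW => m; rewrite cnormB;
    case: (ud m).
apply: asymp_trans (asymp_sym (asympM ub slb ul (asymp_star ul))) _.
by apply: asymp_squeeze d20 _; apply: nearW => m; rewrite cnormB; case: (ud m).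
Qed.

End Unitaries.

Lemma near_unitary_seq (R : realType) (A : cstarType R) (w : nat -> A) :
  asymp (fun k => star (w k) * w k) (fun=> 1) ->
  asymp (fun k => w k * star (w k)) (fun=> 1) ->
  exists2 u, forall k, unitary (u k) & asymp w u.
Proof.
move=> wl wr.
pose d k := cnorm (1 - star (w k) * w k) + cnorm (1 - w k * star (w k)).
have d0 : d @ \oo --> (0 : R).
  rewrite -(addr0 0); apply: cvgD.
    by move: wl; rewrite /asymp; under eq_fun do rewrite cnormB.
  by move: wr; rewrite /asymp; under eq_fun do rewrite cnormB.
have /choice[u uP] : forall k, exists u,
    unitary u /\ (d k <= 2^-1 -> cnorm (w k - u) <= 4 * d k).
  (* [near_unitary] applies once [d k] is at most [2^-1], hence for all large [k]; at the other
     indices [1] is a placeholder. *)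
  move=> k; case: (leP (d k) 2^-1) => [dk|_]; last by exists 1; split => //;
    exact: unitary1.
  have [||u uu wu] := near_unitary dk (w := w k);
    rewrite ?lerDl ?lerDr ?cnorm_ge0 //.
  by exists u.
exists u; first by move=> k; case: (uP k).
apply: (asymp_squeeze (f := fun k => 4 * d k)).
  by rewrite -(mulr0 (4 : R)); apply: cvgM; [exact: cvg_cst|exact: d0].
have half0 : 0 < 2^-1 :> R by rewrite invr_gt0.
move: (d0) => /cvgr0Pnorm_le/(_ _ half0); apply: filterS => k dk.
by case: (uP k) => _; apply; apply: le_trans dk; apply: ler_norm.
Qed.

(** * Linearity and boundedness of star-homomorphisms *)

Section LinearMaps.
Variables (K : pzRingType) (V W : lmodType K) (f : V -> W).
Hypothesis f_linear : linear f.

Lemma linear_mapD x y : f (x + y) = f x + f y.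
Proof. by rewrite -[x in LHS]scale1r f_linear scale1r. Qed.

Lemma linear_map0 : f 0 = 0.
Proof. by apply: (addrI (f 0)); rewrite -linear_mapD !addr0. Qed.

Lemma linear_mapZ c x : f (c *: x) = c *: f x.
Proof. by rewrite -[_ *: x]addr0 f_linear linear_map0 addr0. Qed.

Lemma linear_mapB x y : f (x - y) = f x - f y.
Proof. by rewrite linear_mapD -scaleN1r linear_mapZ scaleN1r. Qed.

Lemma linear_map_sum (I : Type) (r : seq I) (F : I -> V) :
  f (\sum_(i <- r) F i) = \sum_(i <- r) f (F i).
Proof. exact: (big_morph _ linear_mapD linear_map0). Qed.

End LinearMaps.

Section StarHom.
Variables (R : realType) (B A : cstarType R) (f : B -> A).
Hypothesis f_hom : star_hom f.

Let f_linear : linear f. Proof. by case: f_hom. Qed.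
Let f1 : f 1 = 1. Proof. by case: f_hom => _ [[]]. Qed.
Let fM x y : f (x * y) = f x * f y. Proof. by case: f_hom => _ [[]]. Qed.
Let fS x : f (star x) = star (f x). Proof. by case: f_hom => _ []. Qed.

Lemma star_hom_unitary u : unitary u -> unitary (f u).
Proof. by case=> u1 u2; split; rewrite -fS -fM ?u1 ?u2. Qed.

(* [h] is the real part of the unitary [h + i sqrt (1 - h ^ 2)]. *)
Lemma star_hom_selfadjoint_le h :
  star h = h -> cnorm h <= 2^-1 -> cnorm (f h) <= 1.
Proof.
move=> hs /(sqrt_1_sub_sqr hs)[s [ss sh s2]].
have ii : 'i%C * 'i%C = -1 :> R[i] by rewrite -expr2 sqr_i.
have ic : ('i%C : R[i])^* = - 'i%C.
  by rewrite complexiE conjCi.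
have uP : unitary (h + 'i%C *: s).
  rewrite /unitary /= starD starZ ic hs ss; split.
    rewrite mulrDl !mulrDr -!scalerAl
      -!scalerAr !scalerA sh mulNr ii opprK scale1r s2.
    by rewrite scaleNr addrA addrK addrC subrK.
  rewrite mulrDl !mulrDr -!scalerAl
    -!scalerAr !scalerA sh mulrN ii opprK scale1r s2.
  by rewrite scaleNr addrA subrK addrC subrK.
have fu := cnorm_unitary (star_hom_unitary uP).
pose c : R[i] := (2^-1)%:C%C.
have -> : f h = c *: (f (h + 'i%C *: s) + star (f (h + 'i%C *: s))).
  rewrite -fS -(linear_mapD f_linear) starD starZ ic hs ss scaleNr.
  by rewrite addrACA subrr addr0 (linear_mapD f_linear) scaler_half.
rewrite cnorm_half.
have := cnormD (f (h + 'i%C *: s)) (star (f (h + 'i%C *: s))).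
by rewrite cnorm_star fu; lra.
Qed.

(** The C*-identity at [star x * x] reduces to self-adjoint [h]; rescaling [h] to norm [2^-1]
    produces the factor 2. *)
Lemma star_hom_le x : cnorm (f x) <= 2 * cnorm x.
Proof.
suff hle h : star h = h -> cnorm (f h) <= 2 * cnorm h.
  have sxx : star (star x * x) = star x * x by rewrite starM starK.
  have := hle _ sxx; rewrite fM fS !cstar_identity.
  have := cnorm_ge0 x; have := cnorm_ge0 (f x); nra.
move=> hs; have [/cnorm_eq0 ->|h0] := eqVneq (cnorm h) 0.
  by rewrite (linear_map0 f_linear) !cnorm0 mulr0.
have h_gt0 : 0 < cnorm h by rewrite lt_def h0 cnorm_ge0.
pose r := (2 * cnorm h)^-1.
have r_gt0 : 0 < r by rewrite invr_gt0 mulr_gt0.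
have := @star_hom_selfadjoint_le (r%:C%C *: h).
rewrite starZr hs (linear_mapZ f_linear) !cnormZr gtr0_norm //.
have -> : r * cnorm h = 2^-1 by rewrite /r invfM -mulrA mulVf // mulr1.
by move=> /(_ erefl (lexx _)); rewrite /r mulrC ler_pdivrMr ?mulr_gt0 // mul1r.
Qed.

End StarHom.

(** * Asymptotically central matrix units from the UHF factor *)

Section MatrixUnits.
Variables (R : realType) (n : nat).

Definition matrix_units (A : starRingType) (e : 'I_n -> 'I_n -> A) : Prop :=
  [/\ forall i j k l, e i j * e k l = e i l *+ (j == k),
      forall i j, star (e i j) = e j i & \sum_i e i i = 1].

(** The second clause says that the elements eventually commuting exactly with the units are dense.
    Exact commutation is the hypothesis of [cnorm_le_corner]; asymptotic commutation of every
    element follows by approximation. *)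
Definition asymp_central_units (A : cstarType R) (e : nat -> 'I_n -> 'I_n ->
  A) :
    Prop :=
  (forall k, matrix_units (e k)) /\
  forall x (eps : R), 0 < eps -> exists2 y, cnorm (x - y) <= eps &
    \forall k \near \oo, forall i j, y * e k i j = e k i j * y.

Lemma asymp_central_units_iso (B A : cstarType R) (h : B -> A)
    (e : nat -> 'I_n -> 'I_n -> B) :
  star_hom h -> bijective h -> asymp_central_units e ->
  asymp_central_units (fun k i j => h (e k i j)).
Proof.
move=> h_hom [g hg gh] [eU eC]; have [h_lin [[h1 hM] hS]] := h_hom.
split=> [k|x eps eps0].
  have [eM eS e1] := eU k; split=> [i j a b|i j|].
  - rewrite -hM eM; case: eqP => _ //=; exact: linear_map0.
  - by rewrite -hS eS.
  - by rewrite -linear_map_sum // e1.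
(* Halving [eps] absorbs the factor 2 of [star_hom_le]. *)
have [|y yx yC] := eC (g x) (eps / 2); first by rewrite divr_gt0.
exists (h y).
  rewrite -(gh x) -linear_mapB //; apply: le_trans (star_hom_le h_hom _) _; lra.
by move: yC; apply: filterS => k yC i j; rewrite -!hM yC.
Qed.

Lemma tens_delta_units (K : comPzRingType) m (i j k l : 'I_n) :
  ((delta_mx i j *t 1%:M) *m (delta_mx k l *t 1%:M)) =
  (delta_mx i l *t 1%:M) *+ (j == k) :> 'M[K]_(n * m).
Proof.
rewrite tensmx_mul mulmx1 mul_delta_mx_cond.
by case: eqP => // _; rewrite !mulr0n; apply/matrixP => a b; rewrite !mxE mul0r.
Qed.

(** The [k]-th units are [delta_mx i j (x) 1] in [M_n (x) M_(n ^ k.+1)], at stage [k.+1] of the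
    limit. Every stage up to [k] embeds there as [1 (x) m], so it commutes with them, as does the
    image of [A]; sums of products of the two are dense. *)
Lemma asymp_central_units_uhf_tensor (U A UA : cstarType R)
    (U_uhf : is_uhf n U) (UA_tensor : is_min_tensor U A UA) :
  exists e : nat -> 'I_n -> 'I_n -> UA, asymp_central_units e.
Proof.
have [phi [phiP phiS phiD]] := U_uhf.
have [f [g [[f_hom g_hom fg _] UA_dense _]]] := UA_tensor.
have [f_lin [[f1 fM] fS]] := f_hom.
pose d k i j : 'M[R[i]]_(n ^ k.+2) :=
  (delta_mx i j : 'M[R[i]]_n) *t (1%:M : 'M[R[i]]_(n ^ k.+1)).
exists (fun k i j => f (phi k.+1 (d k i j))); split=> [k|x eps eps0].
  have [phi_lin [[phi1 phiM] phiT] _] := phiP k.+1; split=> [i j a b|i j|].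
  - rewrite -fM -phiM; have -> : d k i j * d k a b = d k i b *+ (j == a).
      exact: tens_delta_units.
    by case: eqP => _ //=; rewrite ?mulr0n linear_map0 // linear_map0.
  - rewrite -fS -phiT; congr (f (phi _ _)).
    rewrite /star /= /mxstar /d trmx_tens trmx_delta trmx1.
    apply/matrixP => a b; rewrite !mxE starM mulrC.
    by congr (_ * _); exact: conjC_nat.
  - rewrite -linear_map_sum // -linear_map_sum //.
    have -> : \sum_i d k i i = 1%:M *t 1%:M.
      apply/matrixP => a b; rewrite (@mx1_sum_delta _ n) summxE [RHS]mxE
        summxE mulr_suml.
      by apply: eq_bigr => i _; rewrite !mxE.
    by rewrite phiS; have [_ [[-> _] _] _] := phiP k.
pose commutant := [set y : UA | \forall k \near \oo, forall i j,
  y * f (phi k.+1 (d k i j)) = f (phi k.+1 (d k i j)) * y].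
have phiK k l (m : 'M[R[i]]_(n ^ k.+1)) : (k <= l)%N ->
    exists m' : 'M[R[i]]_(n ^ l.+1), phi k m = phi l m'.
  move=> /subnKC <-; elim: (l - k)%N => [|p [m' ->]]; first by rewrite addn0;
    exists m.
  by rewrite addnS; exists (1%:M *t m'); rewrite phiS.
have commutant_phi k m a : commutant (f (phi k m) * g a).
  exists k => // l /= kl i j; have [m' ->] := phiK k l m kl.
  rewrite -phiS -mulrA -fg !mulrA -!fM; congr (f _ * _).
  have [_ [[_ phiM] _] _] := phiP l.+1; rewrite -!phiM; congr (phi _ _).
  by rewrite /GRing.mul /= /d !tensmx_mul !mul1mx !mulmx1.
have commutantD y z : commutant y -> commutant z -> commutant (y + z).
  by apply: filterS2 => k yC zC i j; rewrite mulrDl mulrDr yC zC.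
have commutant0 : commutant 0 by apply: nearW => k i j; rewrite mul0r mulr0.
have dense_fg b a (r : R) : 0 < r ->
    exists2 y, commutant y & cnorm (f b * g a - y) <= r.
  (* The two factors 2 are those of [star_hom_le] for [f] and [g]; the added 1 keeps [M] positive
     when [a] is 0. *)
  move=> r0; pose M := 2 * (2 * cnorm a) + 1.
  have M0 : 0 < M by rewrite /M; have := cnorm_ge0 a; lra.
  have [|u [k _ [m _ mu]] bu] := phiD b (r / M); first by rewrite divr_gt0.
  exists (f (phi k m) * g a) => //.
  rewrite mu -mulrBl -linear_mapB //.
  apply: le_trans (cnorm_leM (star_hom_le f_hom _) (star_hom_le g_hom _)) _.
  apply: le_trans (_ : M * cnorm (b - u) <= _).
    by rewrite /M; have := cnorm_ge0 (b - u); nra.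
  by rewrite mulrC -ler_pdivlMr // ltW.
have [x' [m [b [a ->]]] xx'] := UA_dense x (eps / 2) ltac:(by rewrite divr_gt0).
have [y yC yx] : exists2 y, commutant y &
    cnorm (\sum_(i < m) f (b i) * g (a i) - y) <= eps / 2.
  (* Dividing by [m.+1] instead of [m] covers the empty sum. *)
  pose r := eps / 2 / m.+1%:R.
  have r0 : 0 < r by rewrite !divr_gt0.
  have /choice[y yP] : forall i, exists y, commutant y /\
      cnorm (f (b i) * g (a i) - y) <= r.
    by move=> i; have [y ? ?] := dense_fg (b i) (a i) r r0; exists y.
  exists (\sum_i y i).
    by apply: (big_ind commutant) => // i _; case: (yP i).
  rewrite -sumrB; apply: le_trans (cnorm_le_sum _ _ _) _.
  apply: (le_trans (ler_sum _ (fun i _ => (yP i).2))).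
  have -> : eps / 2 = r * m.+1%:R by rewrite /r divfK // pnatr_eq0.
  by rewrite sumr_const card_ord -[r *+ m]mulr_natr ler_pM2l // ler_nat leqnSn.
exists y => //; rewrite -(subrKA (\sum_(i < m) f (b i) * g (a i))).
by apply: le_trans (cnorm_leD (ltW xx') yx) _; rewrite -splitr.
Qed.

End MatrixUnits.

(** * Norms relative to a single system of matrix units *)

Section MatrixUnitsNorm.
Variables (R : realType) (n : nat) (A : cstarType R) (e : 'I_n -> 'I_n -> A).
Hypothesis eU : matrix_units e.

Let eM i j k l : e i j * e k l = e i l *+ (j == k). Proof. by case: eU. Qed.
Let eS i j : star (e i j) = e j i. Proof. by case: eU. Qed.
Let e1 : \sum_i e i i = 1. Proof. by case: eU. Qed.

Lemma matrix_unitsM i j l : e i j * e j l = e i l.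
Proof. by rewrite eM eqxx. Qed.

(** By the C*-identity, since [star (e i j) * e i j] is the projection [e j j]. *)
Lemma cnorm_matrix_units i j : cnorm (e i j) <= 1.
Proof.
have ejj : cnorm (e j j) <= 1.
  by apply: cnorm_projection_le1; rewrite eS matrix_unitsM.
have := cstar_identity (e i j); rewrite eS matrix_unitsM.
have := cnorm_ge0 (e i j); nra.
Qed.

Lemma sum_matrix_units_collapse (x : 'I_n -> A) i j :
  \sum_k e i j * e k i * x k = e i i * x j.
Proof.
rewrite (bigD1 j) //= matrix_unitsM big1 ?addr0 // => k kj.
by rewrite eM eq_sym (negPf kj) mul0r.
Qed.

(** The terms are [star z * e j j * z], and the diagonal units sum to 1. Thus the vector with
    entries [e i j * z] has the module norm [cnorm z]. *)
Lemma sum_star_row_units i (z : A) :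
  \sum_j star (e i j * z) * (e i j * z) = star z * z.
Proof.
under eq_bigr do rewrite starM eS mulrA -(mulrA (star z)) matrix_unitsM.
by rewrite -mulr_suml -mulr_sumr e1 mulr1.
Qed.

(* For [h] self-adjoint in the commutant,
   [|h ^ m| = |\sum_i e i i0 * (e i0 i0 * h) ^ m * e i0 i|
            <= n |e i0 i0 * h| ^ m];
   let [m] tend to infinity along the powers of 2, where [|h ^ m| = |h| ^ m]. *)
Lemma cnorm_le_corner (i0 : 'I_n) (y : A) :
  (forall i j, y * e i j = e i j * y) -> cnorm y <= cnorm (e i0 i0 * y).
Proof.
move=> yC; have yCs i j : star y * e i j = e i j * star y.
  by rewrite -[e i j]eS -!starM yC.
pose h := star y * y.
have hC i j : h * e i j = e i j * h.
  by rewrite /h -mulrA yC mulrA yCs mulrA.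
have hs : star h = h by rewrite /h starM starK.
set c := cnorm (e i0 i0 * h).
have hX m : cnorm (h ^+ m) <= n%:R * c ^+ m.
  have hmC i j : h ^+ m * e i j = e i j * h ^+ m by apply/esym/commrX;
    rewrite /GRing.comm hC.
  have hcorner : cnorm (e i0 i0 * h ^+ m) <= c ^+ m.
    elim: m {hmC} => [|m IH]; first by rewrite mulr1 cnorm_matrix_units.
    have -> : e i0 i0 * h ^+ m.+1 = (e i0 i0 * h) * (e i0 i0 * h ^+ m).
      by rewrite mulrA -(mulrA (e _ _)) hC mulrA matrix_unitsM -mulrA -exprS.
    by rewrite exprS cnorm_leM.
  have -> : h ^+ m = \sum_i e i i0 * (e i0 i0 * h ^+ m) * e i0 i.
    under eq_bigr do rewrite -mulrA
      -mulrA hmC mulrA matrix_unitsM mulrA matrix_unitsM.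
    by rewrite -mulr_suml e1 mul1r.
  apply: le_trans (cnorm_le_sum _ _ _) _.
  apply: (@le_trans _ _ (\sum_(i < n) c ^+ m)).
    apply: ler_sum => i _; rewrite -[c ^+ m]mul1r -[leRHS]mulr1.
    exact: (cnorm_leM (cnorm_leM (cnorm_matrix_units _ _) hcorner)
      (cnorm_matrix_units _ _)).
  by rewrite sumr_const card_ord -[c ^+ m *+ n]mulr_natl.
have hc : cnorm h <= c.
  rewrite leNgt; apply/negP => ch.
  have h_gt0 : 0 < cnorm h by apply: le_lt_trans ch; apply: cnorm_ge0.
  have n0 : 0 < n%:R :> R by rewrite ltr0n (leq_ltn_trans _ (ltn_ord i0)).
  have half : 0 < n%:R^-1 :> R by rewrite invr_gt0.
  have ch1 : `|c / cnorm h| < 1.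
    by rewrite ger0_norm ?divr_ge0 ?cnorm_ge0 // ltr_pdivrMr // mul1r.
  (* A ratio below 1 has powers eventually below [1 / n], which contradicts [hX] at the exponent
     [2 ^ N]. *)
  have [N _ NP] := cvgr0_norm_lt _ (cvg_expr ch1) _ half.
  have := NP (2 ^ N)%N (ltnW (ltn_expl N (ltnSn 1))).
  rewrite /= ger0_norm ?exprn_ge0 ?divr_ge0 ?cnorm_ge0 // expr_div_n.
  rewrite ltr_pdivrMr ?exprn_gt0 // ltNge => /negP; apply.
  by rewrite ler_pdivrMl // -cnorm_selfadjointX.
(* By the C*-identity, the bound for [h = star y * y] is the square of the bound sought for [y]. *)
have : cnorm (e i0 i0 * h) = cnorm (e i0 i0 * y) ^+ 2.
  by rewrite -cstar_identity starM eS
    -mulrA [e _ _ * (e _ _ * _)]mulrA matrix_unitsM [in RHS]mulrA yCs -mulrA.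
rewrite -/c; move: hc; rewrite /h cstar_identity => hc cE.
by move: hc; rewrite cE ler_pXn2r // nnegrE cnorm_ge0.
Qed.

End MatrixUnitsNorm.

(** * The asymptotic homomorphism from M_n(A) to A *)

Section Amplification.
Variables (R : realType) (n : nat) (A : cstarType R).
Variable e : nat -> 'I_n -> 'I_n -> A.
Hypothesis e_central : asymp_central_units e.

Let eU k : matrix_units (e k). Proof. by case: e_central. Qed.
Let eb i j : norm_bounded (fun k => e k i j).
Proof. by exists 1 => k; apply: cnorm_matrix_units. Qed.
Let cb := norm_bounded_cst.

Lemma asymp_central_comm x i j :
  asymp (fun k => x * e k i j) (fun k => e k i j * x).
Proof.
apply/asympP => r r0; have r20 : 0 < r / 2 by rewrite divr_gt0.
have [y xy yC] := e_central.2 x _ r20.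
apply: filterS yC => k yC.
have -> : x * e k i j - e k i j * x =
    (x - y) * e k i j - e k i j * (x - y).
  by rewrite mulrBl mulrBr yC opprB addrA subrK.
have := cnorm_leM xy (cnorm_matrix_units (eU k) i j).
have := cnorm_leM (cnorm_matrix_units (eU k) i j) xy.
have := cnormD ((x - y) * e k i j) (- (e k i j * (x - y))).
by rewrite cnormN; lra.
Qed.

(** An exactly commuting [y] within [r / 2] of [x] obeys [cnorm_le_corner]; passing from [x] to [y]
    and back costs [r / 2] each time. *)
Lemma cnorm_le_corner_near (i0 : 'I_n) x (r : R) : 0 < r ->
  \forall k \near \oo, cnorm x <= cnorm (e k i0 i0 * x) + r.
Proof.
move=> r0; have r20 : 0 < r / 2 by rewrite divr_gt0.
have [y xy yC] := e_central.2 x _ r20.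
apply: filterS yC => k yC.
have h1 := cnorm_leB x y; have h2 := cnorm_le_corner (eU k) i0 yC.
have h3 := cnorm_leB (e k i0 i0 * y) (e k i0 i0 * x).
have := cnorm_leM (cnorm_matrix_units (eU k) i0 i0) xy.
by move: h3; rewrite -mulrBr -(cnormN (_ * (y - x))) -mulrN opprB; lra.
Qed.

(* An asymptotically multiplicative section of [a |-> a%:M]. *)
Definition amplify k (X : 'M[A]_n) : A := \sum_i \sum_j X i j * e k i j.

Lemma cnorm_amplify k X : cnorm (amplify k X) <= \sum_i \sum_j cnorm (X i j).
Proof.
apply: le_trans (cnorm_le_sum _ _ _) _; apply: ler_sum => i _.
apply: le_trans (cnorm_le_sum _ _ _) _; apply: ler_sum => j _.
by rewrite -[leRHS]mulr1 cnorm_leM ?cnorm_matrix_units.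
Qed.

Lemma amplify_bounded X : norm_bounded (fun k => amplify k X).
Proof. by exists (\sum_i \sum_j cnorm (X i j)) => k; apply: cnorm_amplify. Qed.

Lemma amplify_scalar k x : amplify k x%:M = x.
Proof.
rewrite /amplify -[RHS]mulr1; have [_ _ <-] := eU k; rewrite mulr_sumr.
apply: eq_bigr => i _; rewrite (bigD1 i) //= mxE eqxx big1 ?addr0 // => j ji.
by rewrite mxE eq_sym (negPf ji) mul0r.
Qed.

Lemma amplifyB k X Y : amplify k (X - Y) = amplify k X - amplify k Y.
Proof.
rewrite /amplify -sumrB; apply: eq_bigr => i _; rewrite -sumrB.
by apply: eq_bigr => j _; rewrite !mxE mulrBl.
Qed.

(** Once [e k i j] has moved past the entries of [X], the unit relations leave row [j] of [X]
    alone. *)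
Lemma asymp_unit_amplify X i j :
  asymp (fun k => e k i j * amplify k X) (fun k => \sum_l X j l * e k i l).
Proof.
apply: (@asymp_trans _ _ (fun k => \sum_a \sum_b e k i j * X a b * e k a b)).
  apply: asymp_eq => k; rewrite /amplify mulr_sumr; apply: eq_bigr => a _.
  by rewrite mulr_sumr; apply: eq_bigr => b _; rewrite mulrA.
apply: (@asymp_trans _ _ (fun k => \sum_a \sum_b X a b * e k i j * e k a b)).
  apply: asymp_sum => a; apply: asymp_sum => b; apply: asympMr => //.
  exact/asymp_sym/asymp_central_comm.
apply: asymp_eq => k; rewrite (bigD1 j) //= [X in _ + X]big1 ?addr0 => [|a aj].
  by apply: eq_bigr => b _; rewrite -mulrA matrix_unitsM.
apply: big1 => b _; have [eM _ _] := eU k.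
by rewrite -mulrA eM eq_sym (negPf aj) mulr0.
Qed.

Lemma asymp_amplifyM X Y :
  asymp (fun k => amplify k X * amplify k Y) (fun k => amplify k (X * Y)).
Proof.
apply: (@asymp_trans _ _ (fun k => \sum_i \sum_j X i j * (e k i j * amplify k
  Y))).
  apply: asymp_eq => k; rewrite mulr_suml; apply: eq_bigr => i _.
  by rewrite mulr_suml; apply: eq_bigr => j _; rewrite mulrA.
apply: (@asymp_trans _ _ (fun k => \sum_i \sum_j X i j * \sum_l Y j l * e k i
  l)).
  apply: asymp_sum => i; apply: asymp_sum => j; apply: asympMl => //.
  exact: asymp_unit_amplify.
apply: asymp_eq => k; apply: eq_bigr => i _.
under eq_bigr do rewrite mulr_sumr; rewrite exchange_big /=.
apply: eq_bigr => l _; rewrite mxE mulr_suml.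
by apply: eq_bigr => j _; rewrite mulrA.
Qed.

Lemma asymp_amplify_star X :
  asymp (fun k => star (amplify k X)) (fun k => amplify k (star X)).
Proof.
apply: (@asymp_trans _ _ (fun k => \sum_i \sum_j e k j i * star (X i j))).
  apply: asymp_eq => k; rewrite star_sum; apply: eq_bigr => i _.
  rewrite star_sum; apply: eq_bigr => j _; rewrite starM.
  by have [_ -> _] := eU k.
apply: (@asymp_trans _ _ (fun k => \sum_i \sum_j star (X i j) * e k j i)).
  apply: asymp_sum => i; apply: asymp_sum => j.
  exact/asymp_sym/asymp_central_comm.
apply: asymp_eq => k; rewrite exchange_big /=; apply: eq_bigr => j _.
by apply: eq_bigr => i _; rewrite !mxE.
Qed.

Lemma amplify_unitary X : unitary X ->
  exists2 u, forall k, unitary (u k) & asymp (fun k => amplify k X) u.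
Proof.
case=> X1 X2; apply: near_unitary_seq.
  apply: (@asymp_trans _ _ (fun k => amplify k (star X) * amplify k X)).
    by apply: asympMr (asymp_amplify_star X); exact: amplify_bounded.
  apply: asymp_trans (asymp_amplifyM _ _) _; rewrite X1.
  by apply: asymp_eq => k; rewrite amplify_scalar.
apply: (@asymp_trans _ _ (fun k => amplify k X * amplify k (star X))).
  by apply: asympMl (asymp_amplify_star X); exact: amplify_bounded.
apply: asymp_trans (asymp_amplifyM _ _) _; rewrite X2.
by apply: asymp_eq => k; rewrite amplify_scalar.
Qed.

Lemma amplify_conj X u x : norm_bounded u -> asymp (fun k => amplify k X) u ->
  asymp (fun k => amplify k (star X * x%:M * X)) (fun k => star (u k) * x * u
    k).
Proof.
move=> ub Xu; have aX := @amplify_bounded.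
apply: asymp_trans (asymp_sym (asymp_amplifyM _ _)) _.
apply: (asympM (aX _) ub _ Xu).
apply: asymp_trans (asymp_sym (asymp_amplifyM _ _)) _.
apply: asympM (aX _) (cb _) _ _.
  apply: asymp_trans (asymp_sym (asymp_amplify_star _)) _.
  exact: (asymp_star Xu).
by apply: asymp_eq => k; rewrite amplify_scalar.
Qed.

(** * The Hilbert module A^n and the operator norm of M_n(A), seen inside A *)

(** Encodes [v] as column [i0] of a matrix. For [z] the result, [star z * z] is asymptotically the
    inner square of [v] cut down by [e k i0 i0], and by [cnorm_le_corner_near] this cut
    asymptotically loses no norm. *)
Definition column (i0 : 'I_n) k (v : 'cV[A]_n) : A := \sum_j e k j i0 * v j 0.

Lemma column_bounded i0 v : norm_bounded (fun k => column i0 k v).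
Proof. by apply: norm_bounded_sum => j; apply: norm_boundedM. Qed.

Lemma asymp_star_column i0 v :
  asymp (fun k => star (column i0 k v) * column i0 k v)
        (fun k => e k i0 i0 * \sum_j star (v j 0) * v j 0).
Proof.
apply: (@asymp_trans _ _ (fun k => \sum_j star (v j 0) * e k i0 i0 * v j 0)).
  apply: asymp_eq => k; have [eM eS _] := eU k.
  rewrite /column star_sum mulr_suml; apply: eq_bigr => i _.
  rewrite starM eS -!mulrA mulr_sumr; congr (_ * _).
  under eq_bigr do rewrite mulrA.
  exact: sum_matrix_units_collapse.
apply: (@asymp_trans _ _ (fun k => \sum_j e k i0 i0 * star (v j 0) * v j 0)).
  apply: asymp_sum => j; apply: asympMr => //; exact: asymp_central_comm.
by apply: asymp_eq => k; rewrite mulr_sumr; apply: eq_bigr => j _;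
  rewrite mulrA.
Qed.

Lemma asymp_amplify_column i0 X v :
  asymp (fun k => amplify k X * column i0 k v) (fun k => column i0 k (X *m v)).
Proof.
apply: (@asymp_trans _ _ (fun k => \sum_i \sum_j X i j * e k i i0 * v j 0)).
  apply: asymp_eq => k; rewrite /amplify mulr_suml; apply: eq_bigr => i _.
  rewrite mulr_suml; apply: eq_bigr => j _; rewrite /column -!mulrA;
    congr (_ * _).
  rewrite mulr_sumr (bigD1 j) //= mulrA matrix_unitsM // big1 ?addr0 // => l lj.
  by have [eM _ _] := eU k; rewrite mulrA eM eq_sym (negPf lj) mul0r.
apply: (@asymp_trans _ _ (fun k => \sum_i \sum_j e k i i0 * X i j * v j 0)).
  apply: asymp_sum => i; apply: asymp_sum => j; apply: asympMr => //.
  exact: asymp_central_comm.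
apply: asymp_eq => k; apply: eq_bigr => i _; rewrite mxE mulr_sumr.
by apply: eq_bigr => j _; rewrite mulrA.
Qed.

Lemma module_norm_sqr (v : 'cV[A]_n) :
  module_norm v ^+ 2 = cnorm (\sum_j star (v j 0) * v j 0).
Proof. by rewrite sqr_sqrtr // cnorm_ge0. Qed.

(** Up to small errors, the norm of [X *m v] is that of [amplify k X * column i0 k v], to which
    submultiplicativity in [A] applies. *)
Lemma module_norm_mul_le (i0 : 'I_n) X (C : R) v :
  (forall k, cnorm (amplify k X) <= C) ->
  module_norm (X *m v) <= C * module_norm v.
Proof.
move=> XC; have C0 : 0 <= C := le_trans (cnorm_ge0 _) (XC 0%N).
rewrite -(@ler_pXn2r _ 2) ?nnegrE ?mulr_ge0
  ?sqrtr_ge0 // exprMn !module_norm_sqr.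
set s := \sum_j _; set t := \sum_j _.
apply/ler_addgt0Pr => r r0.
(* The total error is [d] for the corner, [d] for encoding [X *m v], and [C ^+ 2 * d] for encoding
   [v]. *)
pose d := r / (C ^+ 2 + 2).
have C2 : 0 < C ^+ 2 + 2 by rewrite ltr_wpDl ?sqr_ge0.
have d0 : 0 < d by rewrite divr_gt0.
have Xz : asymp (fun k => e k i0 i0 * s)
    (fun k => star (amplify k X * column i0 k v) * (amplify k X * column i0 k
      v)).
  apply: asymp_trans (asymp_sym (asymp_star_column _ _)) _; apply: asymp_sym.
  have ab := amplify_bounded X; have zb := column_bounded i0 v.
  have := asymp_amplify_column i0 X v.
  move=> az; apply: (asympM _ (column_bounded _ _) (asymp_star az) az).
  by apply: norm_bounded_star; apply: norm_boundedM.
have h1 := cnorm_le_corner_near i0 s d0.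
have h2 := asymp_norm_le Xz d0.
have h3 := asymp_norm_le (asymp_star_column i0 v) d0.
have [k /= [[k1 k2] k3]] := filter_ex (filterI (filterI h1 h2) h3).
move: k2 k3; rewrite !cstar_identity => k2 k3.
have k4 : cnorm (amplify k X * column i0 k v) ^+ 2 <= C ^+ 2 * cnorm (column
  i0 k v) ^+ 2.
  rewrite -exprMn ler_pXn2r ?nnegrE ?cnorm_ge0 ?mulr_ge0 ?cnorm_ge0 //.
  exact: cnorm_leM.
have k5 : cnorm (e k i0 i0 * t) <= cnorm t.
  by rewrite -[leRHS]mul1r cnorm_leM ?cnorm_matrix_units.
have k6 : C ^+ 2 * cnorm (column i0 k v) ^+ 2 <= C ^+ 2 * (cnorm t + d).
  by rewrite ler_wpM2l ?sqr_ge0 //; lra.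
have -> : r = d * (C ^+ 2 + 2) by rewrite divfK // gt_eqF.
lra.
Qed.

(* [v |-> \sum_j star (v j) * v j] takes the value [star z * z] at the vector
   [v j = e k i0 j * z], and [X *m v] is close to the vector attached to
   [amplify k X * z]; take [z] proportional to the adjoint of [amplify k X]. *)
Lemma amplify_le_near (i0 : 'I_n) X (N r : R) : 0 < r ->
  (forall v, module_norm v <= 1 -> module_norm (X *m v) <= N) ->
  \forall k \near \oo, cnorm (amplify k X) ^+ 2 <= N ^+ 2 + r.
Proof.
move=> r0 XN; pose y k := amplify k X.
(* Normalised so that [y k * z k] has the norm of [y k]; if [y k = 0], the convention [0^-1 = 0]
   gives [z k = 0]. *)
pose z k := ((cnorm (y k))^-1)%:C%C *: star (y k).
have z1 k : cnorm (z k) <= 1.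
  rewrite /z cnormZr ger0_norm ?invr_ge0 ?cnorm_ge0 // cnorm_star.
  by have [->|y0] := eqVneq (cnorm (y k)) 0; rewrite ?mulr0 ?mulVf.
have yz k : cnorm (y k * z k) = cnorm (y k).
  rewrite /z -scalerAr cnormZr ger0_norm ?invr_ge0 ?cnorm_ge0 //.
  rewrite -{2}[y k]starK cstar_identity cnorm_star.
  by have [->|y0] := eqVneq (cnorm (y k)) 0;
    rewrite ?expr0n ?mulr0 // expr2 mulKf.
have zb : norm_bounded z by exists 1.
pose v k : 'cV[A]_n := \col_j (e k i0 j * z k).
have v1 k : module_norm (v k) <= 1.
  rewrite -(@ler_pXn2r _ 2) ?nnegrE ?sqrtr_ge0 ?ler01 // module_norm_sqr.
  under eq_bigr do rewrite mxE.
  rewrite sum_star_row_units // cstar_identity expr1n.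
  by rewrite expr_le1 // cnorm_ge0.
have pq i : asymp (fun k => e k i0 i * (y k * z k)) (fun k => (X *m v k) i 0).
  apply: (@asymp_trans _ _ (fun k => (\sum_j X i j * e k i0 j) * z k)).
    apply: (@asymp_trans _ _ (fun k => e k i0 i * y k * z k)).
      by apply: asymp_eq => k; rewrite mulrA.
    by apply: asympMr => //; exact: asymp_unit_amplify.
  apply: asymp_eq => k; rewrite mxE mulr_suml; apply: eq_bigr => j _.
  by rewrite mxE mulrA.
have qb i : norm_bounded (fun k => e k i0 i * (y k * z k)).
  by do 2!apply: norm_boundedM => //; exact: amplify_bounded.
have pb i : norm_bounded (fun k => (X *m v k) i 0).
  have [M Mb] : norm_bounded (fun k => \sum_j X i j * (e k i0 j * z k)).
    by apply: norm_bounded_sum => j; do 2!apply: norm_boundedM => //.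
  by exists M => k; rewrite mxE; under eq_bigr do rewrite mxE.
have sum_pq : asymp (fun k => star (y k * z k) * (y k * z k))
    (fun k => \sum_i star ((X *m v k) i 0) * (X *m v k) i 0).
  apply: (@asymp_trans _ _ (fun k =>
    \sum_i star (e k i0 i * (y k * z k)) * (e k i0 i * (y k * z k)))).
    by apply: asymp_eq => k; rewrite sum_star_row_units.
  apply: asymp_sum => i; apply: (asympM _ (pb i) (asymp_star (pq i)) (pq i)).
  exact: norm_bounded_star (qb i).
have := asymp_norm_le sum_pq r0; apply: filterS => k.
rewrite cstar_identity yz -module_norm_sqr => /le_trans; apply.
rewrite lerD2r ler_pXn2r ?nnegrE ?sqrtr_ge0 //; first exact: XN.
exact: le_trans (sqrtr_ge0 _) (XN _ (v1 k)).
Qed.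

(** The set under [sup] is bounded above by [module_norm_mul_le], with the bound of [cnorm_amplify],
    uniform in [k], as constant. *)
Lemma mx_norm_op_ge (i0 : 'I_n) (X : 'M[A]_n) v :
  module_norm v <= 1 -> module_norm (X *m v) <= mx_norm_op X.
Proof.
move=> v1; apply: sup_upper_bound; last by exists v.
split; first by exists (module_norm (X *m v)), v.
exists (\sum_i \sum_j cnorm (X i j)) => _ [w /= w1 <-].
apply: le_trans (module_norm_mul_le i0 w (fun k => cnorm_amplify k X)) _.
rewrite ler_piMr //; apply: sumr_ge0 => i _; apply: sumr_ge0 => j _;
  exact: cnorm_ge0.
Qed.

Lemma module_norm0 : module_norm (0 : 'cV[A]_n) = 0.
Proof.
rewrite /module_norm big1 ?cnorm0 ?sqrtr0 // => j _.
by rewrite mxE mulr0.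
Qed.

Lemma mx_norm_op_ge0 (i0 : 'I_n) (X : 'M[A]_n) : 0 <= mx_norm_op X.
Proof.
by apply: le_trans (sqrtr_ge0 _) (mx_norm_op_ge i0 X (v := 0) _);
  rewrite module_norm0.
Qed.

(** [amplify k x%:M] is [x] itself, so [module_norm_mul_le] applies with [C = cnorm x]. *)
Lemma mx_norm_op_scalar_le (i0 : 'I_n) (x : A) :
  mx_norm_op (x%:M : 'M[A]_n) <= cnorm x.
Proof.
apply: ge_sup; first by exists (module_norm (x%:M *m (0 : 'cV[A]_n))), 0;
  rewrite //= module_norm0.
move=> _ [v /= v1 <-].
apply: le_trans (module_norm_mul_le i0 (C := cnorm x) v _) _.
  by move=> k; rewrite amplify_scalar.
by rewrite ler_piMr ?cnorm_ge0.
Qed.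

(** * Comparison of the two orbit distances *)

(** A unitary [u] of [A] gives the unitary [u%:M] of M_n(A), so each value for [A] dominates one for
    M_n(A). *)
Lemma orbit_distM_le (i0 : 'I_n) (a b : A) :
  orbit_dist (@mx_norm_op R A n) a%:M b%:M <= orbit_dist (@cnorm R A) a b.
Proof.
have scalar_star (x : A) : star (x%:M : 'M[A]_n) = (star x)%:M.
  apply/matrixP => i j; rewrite !mxE eq_sym.
  by case: eqP => _; rewrite ?mulr1n // !mulr0n star0.
have scalarU (u : A) : unitary u -> unitary (u%:M : 'M[A]_n).
  by case=> u1 u2; split; rewrite scalar_star /GRing.mul /= -scalar_mxM ?u1 ?u2.
apply: lb_le_inf; first exact: orbit_dist_values_neq0.
move=> _ [_ [u uU <-] [_ [v vU <-] <-]].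
apply: le_trans (mx_norm_op_scalar_le i0 _).
apply: inf_lbound.
  by exists 0 => _ [x' _ [y' _ <-]]; exact: mx_norm_op_ge0.
exists (star u * a * u)%:M.
  by exists u%:M; [exact: scalarU|rewrite scalar_star /GRing.mul /=
    -!scalar_mxM].
exists (star v * b * v)%:M; last by rewrite raddfB.
by exists v%:M; [exact: scalarU|rewrite scalar_star /GRing.mul /= -!scalar_mxM].
Qed.

(** Amplified unitaries are close to unitaries [u k] and [v k] of [A]; the resulting difference in
    [A] is close to [amplify k Z], whose norm eventually exceeds that of [Z] by at most [r / 2]. *)
Lemma orbit_dist_leM (i0 : 'I_n) (a b : A) :
  orbit_dist (@cnorm R A) a b <= orbit_dist (@mx_norm_op R A n) a%:M b%:M.
Proof.
apply: lb_le_inf; first exact: orbit_dist_values_neq0.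
move=> _ [_ [X XU <-] [_ [Y YU <-] <-]].
set Z := _ - _; apply/ler_addgt0Pr => r r0.
have [u uU Xu] := amplify_unitary XU; have [v vU Yv] := amplify_unitary YU.
have ub : norm_bounded u by exists 1 => k; rewrite cnorm_unitary.
have vb : norm_bounded v by exists 1 => k; rewrite cnorm_unitary.
have Zuv : asymp (fun k => star (u k) * a * u k - star (v k) * b * v k)
                 (fun k => amplify k Z).
  apply: asymp_sym; apply: (asymp_trans _ (asympB (amplify_conj a ub Xu)
    (amplify_conj b vb Yv))).
  by apply: asymp_eq => k; rewrite amplifyB.
have r20 : 0 < r / 2 by rewrite divr_gt0.
have r2s : 0 < (r / 2) ^+ 2 by rewrite exprn_gt0.
have h1 := asymp_norm_le Zuv r20.
have h2 := amplify_le_near i0 r2s (fun w => mx_norm_op_ge i0 Z (v := w)).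
have [k /= [k1 k2]] := filter_ex (filterI h1 h2).
have N0 := mx_norm_op_ge0 i0 Z.
(* With [N] the norm of [Z], this uses [N ^+ 2 + (r / 2) ^+ 2 <= (N + r / 2) ^+ 2], hence the error
   [(r / 2) ^+ 2] above. *)
have k3 : cnorm (amplify k Z) <= mx_norm_op Z + r / 2.
  rewrite -(@ler_pXn2r _ 2) ?nnegrE ?cnorm_ge0 ?(addr_ge0 N0 (ltW r20)) //.
  by apply: le_trans k2 _; rewrite sqrrD; have := mulr_ge0 N0 (ltW r20); lra.
apply: le_trans (_ : cnorm (star (u k) * a * u k
  - star (v k) * b * v k) <= _); last lra.
apply: inf_lbound; first by exists 0 => _ [x' _ [y' _ <-]]; exact: cnorm_ge0.
exists (star (u k) * a * u k); first by exists (u k).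
by exists (star (v k) * b * v k) => //; exists (v k).
Qed.

End Amplification.

Theorem proposition4p4 (R : realType) (n : nat) (n_gt0 : (0 < n)%N)
    (A : cstarType R) (A_separable : separable_cstar A)
    (U : cstarType R) (U_uhf : is_uhf n U)
    (UA : cstarType R) (UA_tensor : is_min_tensor U A UA)
    (UA_iso_A : star_isomorphic UA A)
    (a b : A) :
  orbit_dist (@cnorm R A) a b =
  orbit_dist (@mx_norm_op R A n) (a%:M : 'M[A]_n) (b%:M : 'M[A]_n).
Proof.
have [e e_central] := asymp_central_units_uhf_tensor U_uhf UA_tensor.
have [h h_hom h_bij] := UA_iso_A.
have he := asymp_central_units_iso h_hom h_bij e_central.
(* Positivity of [n] supplies the corner index for both inequalities. *)
have i0 := Ordinal n_gt0.
by apply/le_anti; rewrite (orbit_dist_leM he) ?(orbit_distM_le he).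
Qed.
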